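(* Let $\Gamma$ be a finite, simple, connected, bipartite $k$-regular graph whose adjacency spectrum is $\{[\pm k]^{1}, [\pm\theta]^{a}, [0]^{b}\}$, where $a \geq 1$, $b \geq 0$, $\theta > 0$, and the displayed eigenvalues $k, -k, \theta, -\theta$ (and $0$ if $b\ge 1$) are pairwise distinct. Then $\Gamma$ is periodic if and only if $k$ is even and $\theta \in \left\{ \frac{k}{2}, \frac{\sqrt{2}}{2}k, \frac{\sqrt{3}}{2}k \right\}$.
   Context: All graphs are finite, simple and connected. The adjacency spectrum of a graph is the multiset of eigenvalues of its adjacency matrix. The notation $\{[\pm k]^{1}, [\pm\theta]^{a}, [0]^{b}\}$ means that $k$ and $-k$ each have multiplicity $1$, $\theta$ and $-\theta$ each have multiplicity $a$, and $0$ has multiplicity $b$ (if $b=0$, then $0$ is not an eigenvalue). Grover walk and periodicity: for a graph $\Gamma=(V,E)$, let $\mathcal{A}=\{(x,y),(y,x)\mid \{x,y\}\in E\}$ be its set of arcs; for $e=(x,y)\in\mathcal{A}$ write $t(e)=y$ for the terminus and $e^{-1}=(y,x)$ for the inverse arc. The boundary matrix $d\in\mathbb{C}^{V\times\mathcal{A}}$ is $d_{x,e}=\frac{1}{\sqrt{\deg x}}\delta_{x,t(e)}$, the shift matrix $S\in\mathbb{C}^{\mathcal{A}\times\mathcal{A}}$ is $S_{e,f}=\delta_{e,f^{-1}}$, and the time evolution matrix is $U=S(2d^*d-I)\in\mathbb{C}^{\mathcal{A}\times\mathcal{A}}$, where $d^*$ is the conjugate transpose of $d$ and $\delta$ is the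 Kronecker delta. The graph $\Gamma$ is called periodic if there exists a positive integer $\tau$ with $U^{\tau}=I$. *)

(* Defs.v *)
From mathcomp Require Import all_boot all_order all_algebra.

Set Implicit Arguments.
Unset Strict Implicit.
Unset Printing Implicit Defensive.

Import Order.TTheory GRing.Theory Num.Theory.
Local Open Scope ring_scope.
Local Open Scope sesquilinear_scope.

(* A finite simple graph is a symmetric irreflexive [e : rel V] on a finType;
   a matrix indexed by a finType T is a matrix over 'I_#|T|, read through
   [enum_val].  The scalars form an arbitrary numClosedFieldType C; this covers
   the field R[i] of complex numbers over the reals R as well as algC. *)

Definition simple_graph (V : finType) (e : rel V) : Prop :=
  symmetric e /\ irreflexive e.

Definition connected_graph (V : finType) (e : rel V) : Prop :=
  forall x y : V, connect e x y.

Definition bipartite (V : finType) (e : rel V) : Prop :=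
  exists side : V -> bool, forall x y : V, e x y -> side x != side y.

Definition deg (V : finType) (e : rel V) (x : V) : nat := #|[set y | e x y]|.

Definition regular (V : finType) (e : rel V) (k : nat) : Prop :=
  forall x : V, deg e x = k.

Definition adjacency (C : numClosedFieldType) (V : finType) (e : rel V) :
    'M[C]_#|V| :=
  \matrix_(i, j) (e (enum_val i) (enum_val j))%:R.

(* The sequence of roots of the characteristic polynomial, each repeated
   according to its multiplicity.  The order is unspecified: compare spectra
   with [perm_eq]. *)
Definition spectrum (C : numClosedFieldType) (n : nat) (A : 'M[C]_n) : seq C :=
  sval (closed_field_poly_normal (char_poly A)).

Section GroverWalk.

Variables (C : numClosedFieldType) (V : finType) (e : rel V).

Definition arc : finType := {p : V * V | e p.1 p.2}.

Definition terminus (u : arc) : V := (val u).2.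

(* [inverse_arc u v] says that u = v^-1.  It is a relation because reversal is
   an operation on arcs only when [e] is symmetric. *)
Definition inverse_arc (u v : arc) : bool :=
  val u == ((val v).2, (val v).1).

Definition boundary : 'M[C]_(#|V|, #|arc|) :=
  \matrix_(i, j) ((sqrtC (deg e (enum_val i))%:R)^-1
                  * (enum_val i == terminus (enum_val j))%:R).

Definition shift : 'M[C]_#|arc| :=
  \matrix_(i, j) (inverse_arc (enum_val i) (enum_val j))%:R.

Definition evolution : 'M[C]_#|arc| :=
  shift *m (2%:R *: (boundary^t* *m boundary) - 1%:M).

Definition periodic : Prop :=
  exists2 tau : nat, (0 < tau)%N & evolution ^+ tau = 1%:M.

End GroverWalk.

(* Main.v *)
(* Write T = d S d^* = A / k.  If T v = c v, the span of d^* v and S d^* v is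
   invariant under U, and when c <> +-1 the eigenvalues of U there are the roots
   of mu ^ 2 - 2 c mu + 1, so that mu + 1 / mu = 2 c.

   If U ^ tau = 1, these mu are roots of unity, so 2 theta / k is an algebraic
   integer of absolute value at most 2.  The trace of A ^ 2 shows that
   theta ^ 2 is rational.  Hence z = (2 theta / k) ^ 2 is an integer with
   0 < z < 4; theta ^ 2 is an integer as well, and z k ^ 2 = 4 theta ^ 2 forces
   k to be even.

   Conversely, if z is 1, 2 or 3, all the roots mu above have order dividing 24.
   Since T is diagonalizable, U ^ 24 fixes the columns of d^* and S d^*; on the
   orthogonal complement U is an involution. *)

Require Import Defs.
From mathcomp Require Import all_boot all_order all_algebra all_field.
From mathcomp Require Import ring zify.

Set Implicit Arguments.
Unset Strict Implicit.
Unset Printing Implicit Defensive.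

Import Order.TTheory GRing.Theory Num.Theory.
Local Open Scope ring_scope.
Local Open Scope sesquilinear_scope.

(** * Eigenvectors, adjoints and normal matrices *)

Lemma expmx_eigenvector (R : comNzRingType) (m : nat) (U : 'M[R]_m)
    (w : 'cV[R]_m) (mu : R) (n : nat) :
  U *m w = mu *: w -> U ^+ n *m w = mu ^+ n *: w.
Proof.
move=> Uw; elim: n => [|n IHn]; first by rewrite !expr0 scale1r mul1mx.
by rewrite exprS -mulmxE -mulmxA IHn -scalemxAr Uw scalerA -exprSr.
Qed.

(** The diagonal entries of the product are the squared norms of the columns of [w]. *)
Lemma ctmx_mul_eq0 (C : numClosedFieldType) (m n : nat) (w : 'M[C]_(m, n)) :
  w^t* *m w = 0 -> w = 0.
Proof.
move=> /matrixP w0; apply/matrixP => i j; rewrite mxE; apply/eqP.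
have /eqP := w0 j j; rewrite !mxE psumr_eq0 => [/allP /(_ i)|l _].
  rewrite mem_index_enum => /(_ isT) /=.
  by rewrite !mxE mulrC -normCK sqrf_eq0 normr_eq0.
by rewrite !mxE mulrC mul_conjC_ge0.
Qed.

Lemma trmxC_mul (C : numClosedFieldType) (m n p : nat)
    (A : 'M[C]_(m, n)) (B : 'M[C]_(n, p)) : (A *m B)^t* = B^t* *m A^t*.
Proof. by rewrite trmx_mul map_mxM. Qed.

Lemma char_poly_conjmx (R : comUnitRingType) (n : nat) (P A : 'M[R]_n) :
  P \in unitmx -> char_poly (invmx P *m A *m P) = char_poly A.
Proof.
move=> Pu; pose Q := map_mx (@polyC R) P.
pose Q' := map_mx (@polyC R) (invmx P).
have QQ : Q' *m Q = 1%:M by rewrite -map_mxM mulVmx // map_mx1.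
rewrite /char_poly.
have -> : char_poly_mx (invmx P *m A *m P) = Q' *m char_poly_mx A *m Q.
  rewrite /char_poly_mx mulmxBr mulmxBl !map_mxM.
  by rewrite -/Q -/Q' scalar_mxC -(mulmxA _ Q') QQ mulmx1.
by rewrite !det_mulmx mulrAC -det_mulmx QQ det1 mul1r.
Qed.

Lemma char_poly_normalmx (C : numClosedFieldType) (n : nat) (A : 'M[C]_n) :
  A \is normalmx ->
  char_poly A = \prod_(i < n) ('X - (spectral_diag A 0 i)%:P).
Proof.
move=> /orthomx_spectralP AE; rewrite {1}AE char_poly_conjmx ?spectral_unit //.
rewrite char_poly_trig ?diag_mx_is_trig //; apply: eq_bigr => i _.
by rewrite mxE eqxx.
Qed.

(** The columns of [invmx (spectralmx A)] form a basis of eigenvectors of [A], and agreement on a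
    basis suffices. *)
Lemma normalmx_eq_on_eigenvectors (C : numClosedFieldType) (m n : nat)
    (A : 'M[C]_n) (X Y : 'M[C]_(m, n)) :
  A \is normalmx ->
  (forall (c : C) (v : 'cV_n), root (char_poly A) c -> A *m v = c *: v ->
     X *m v = Y *m v) ->
  X = Y.
Proof.
move=> Anormal eqXY; have := Anormal => /orthomx_spectralP AE.
set P := spectralmx A in AE; set D := spectral_diag A in AE.
have Pu : P \in unitmx by apply: spectral_unit.
rewrite -[X]mulmx1 -[Y]mulmx1 -(mulVmx Pu) !mulmxA; congr (_ *m _).
apply/row_matrixP => i; apply/rowP => j; rewrite !mxE.
suff /colP/(_ i) : X *m col j (invmx P) = Y *m col j (invmx P).
  rewrite !mxE; under eq_bigr do rewrite mxE.
  by under [X in _ = X]eq_bigr do rewrite mxE.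
apply: (eqXY (D 0 j)).
  rewrite (char_poly_normalmx Anormal) /root horner_prod (bigD1 j) //=.
  by rewrite hornerXsubC subrr mul0r.
have AP : A *m invmx P = invmx P *m diag_mx D by rewrite AE mulmxK.
rewrite !colE mulmxA AP -!colE; apply/colP => l.
by rewrite mxE mul_mx_diag !mxE mulrC.
Qed.

(** * The walk of a coisometry and a self-adjoint involution *)

Section AbstractWalk.

Variables (C : numClosedFieldType) (n m : nat) (d : 'M[C]_(n, m)) (S : 'M[C]_m).
Hypotheses (d_coisometry : d *m d^t* = 1%:M) (S_inv : S *m S = 1%:M).
Hypothesis S_herm : S^t* = S.

Let U := S *m (2%:R *: (d^t* *m d) - 1%:M).
Let T := d *m S *m d^t*.

(** The second factor of [U] is the reflection fixing the range of the adjoint of [d]. *)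
Lemma walk_boundary : U *m d^t* = S *m d^t*.
Proof.
rewrite /U -mulmxA mulmxBl -scalemxAl -mulmxA d_coisometry mulmx1 mul1mx.
by rewrite scaler_nat mulr2n addrK.
Qed.

Lemma walk_shift_boundary :
  U *m (S *m d^t*) = 2%:R *: (S *m d^t* *m T) - d^t*.
Proof.
rewrite /U /T -!mulmxA mulmxBl -scalemxAl mul1mx mulmxBr -scalemxAr.
by rewrite [S *m (S *m _)]mulmxA S_inv mul1mx -!mulmxA.
Qed.

Section Eigenvector.

Variables (c : C) (v : 'cV[C]_n).
Hypothesis Tv : T *m v = c *: v.

Let x := d^t* *m v.
Let y := S *m x.

Lemma walk_x : U *m x = y.
Proof. by rewrite /x mulmxA walk_boundary -mulmxA. Qed.

Lemma walk_y : U *m y = (c *+ 2) *: y - x.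
Proof.
rewrite /y /x [S *m _]mulmxA mulmxA walk_shift_boundary mulmxBl -scalemxAl.
by rewrite -[_ *m T *m v]mulmxA Tv -scalemxAr scalerA mulr_natl.
Qed.

(** The vector [mu *: y - x] is an eigenvector of [U] for [mu], and it is nonzero because [c]
    differs from 1 and -1. *)
Lemma walk_eigenvalue_order (mu : C) (tau : nat) :
  v != 0 -> c ^+ 2 != 1 -> mu ^+ 2 + 1 = c *+ 2 * mu ->
  U ^+ tau = 1%:M -> mu ^+ tau = 1.
Proof.
move=> v0 c1 mu_eq Utau; pose w := mu *: y - x.
have Uw : U *m w = mu *: w.
  rewrite /w mulmxBr -scalemxAr walk_x walk_y !scalerBr !scalerA.
  rewrite mulrC -mu_eq scalerDl scale1r expr2.
  by rewrite addrAC addrK.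
have w0 : w != 0.
  (* Applying [d] to [w] gives [(mu * c - 1) *: v]. If this vanishes, then [mu * c = 1], the
     quadratic equation yields [mu ^+ 2 = 1], and so [c ^+ 2 = 1]. *)
  apply: contraNneq c1 => w0.
  have : d *m w = 0 by rewrite w0 mulmx0.
  rewrite /w mulmxBr -scalemxAr /y /x !mulmxA d_coisometry mul1mx -/T Tv.
  rewrite scalerA -[X in _ - X]scale1r -scalerBl => /eqP.
  rewrite scaler_eq0 (negPf v0) orbF subr_eq0 => /eqP muc.
  have : mu ^+ 2 = 1.
    by apply: (addIr 1); rewrite mu_eq mulrnAl mulrC muc.
  by move=> mu1; rewrite -[c ^+ 2]mul1r -[X in X * _]mu1 -exprMn muc expr1n.
have := expmx_eigenvector tau Uw; rewrite Utau mul1mx -[LHS]scale1r => /eqP.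
by rewrite -subr_eq0 -scalerBl scaler_eq0 (negPf w0) orbF subr_eq0 => /eqP.
Qed.

(** On the span of [x] and [y], [U] is annihilated by X^2 - 2 c X + 1. *)
Lemma walk_pow_step (j : nat) :
  U ^+ j.+2 *m x = (c *+ 2) *: (U ^+ j.+1 *m x) - U ^+ j *m x.
Proof.
rewrite !exprSr -!mulmxE -(mulmxA (U ^+ j *m U)) -!(mulmxA (U ^+ j)).
by rewrite walk_x walk_y mulmxBr -scalemxAr.
Qed.

(** Eliminating the intermediate powers leaves only the square of 2 c, which is an integer in the
    cases of interest even when 2 c is irrational. *)
Lemma walk_pow_double_step (j : nat) :
  U ^+ j.+4 *m x = ((c *+ 2) ^+ 2 - 2%:R) *: (U ^+ j.+2 *m x) - U ^+ j *m x.
Proof.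
have e0 : (c *+ 2) *: (U ^+ j.+1 *m x) = U ^+ j.+2 *m x + U ^+ j *m x.
  by rewrite walk_pow_step subrK.
rewrite walk_pow_step [U ^+ j.+3 *m x]walk_pow_step scalerBr scalerA -expr2 e0.
by rewrite scalerBl scaler_nat mulr2n !opprD !addrA [LHS]addrAC.
Qed.

(* Over the eigenvalues +-1 the plane spanned by [x] and [y] collapses to a
   line: the squared norm of [y - c x] is [2 (1 - c ^ 2)] times that of [v]. *)
Lemma walk_extremal : c ^+ 2 = 1 -> y = c *: x.
Proof.
move=> c1; have cR : c \is Num.real.
  by move/eqP: c1; rewrite sqrf_eq1 => /orP[] /eqP->; rewrite ?rpredN rpred1.
apply/eqP; rewrite -subr_eq0; apply/eqP/ctmx_mul_eq0.
have -> : (y - c *: x)^t* = v^t* *m (d *m S - c *: d).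
  rewrite linearB linearZ map_mxB map_mxZ /= (CrealP cR).
  by rewrite /y /x !trmxC_mul S_herm trmxCK mulmxBr -scalemxAr !mulmxA.
have -> : y - c *: x = (S *m d^t* - c *: d^t*) *m v.
  by rewrite mulmxBl -scalemxAl /y /x mulmxA.
rewrite -mulmxA (mulmxA (d *m S - _)) mulmxBl !mulmxBr -!scalemxAl -!scalemxAr.
rewrite !mulmxA -(mulmxA d S S) S_inv mulmx1 d_coisometry scalerA -expr2 c1.
rewrite -/T scale1r -mulmxA !mulmxBl mul1mx -scalemxAl Tv scalerA -expr2 c1.
by rewrite scale1r !subrr mulmx0.
Qed.

(** If [c ^+ 2 = 1], then [U] multiplies [x] by [c]. If the square of 2 c is 0, 1, 2 or 3, then on
    the orbit of [x] respectively U^2 = -1, U^6 = 1, U^4 = -1 or U^6 = -1. The resulting periods 2,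
    4, 6, 8 and 12 all divide 24. *)
Lemma walk_period24 :
    c ^+ 2 = 1 \/ (c *+ 2) ^+ 2 \in [:: 0; 1; 2%:R; 3%:R] ->
  U ^+ 24 *m x = x.
Proof.
have pow0 : U ^+ 0 *m x = x by rewrite expr0 mul1mx.
have dbl := walk_pow_double_step.
case=> [c1|].
  rewrite (expmx_eigenvector _ (_ : U *m x = c *: x)).
    by rewrite (exprM c 2 12) c1 expr1n scale1r.
  by rewrite walk_x walk_extremal.
have iter (p q : nat) (s : C) :
    (forall j, U ^+ (p + j) *m x = s *: (U ^+ j *m x)) ->
    U ^+ (p * q) *m x = s ^+ q *: x.
  move=> step; elim: q => [|q IHq]; first by rewrite muln0 pow0 scale1r.
  by rewrite mulnS step IHq scalerA -exprS.
rewrite !inE => /or4P[] /eqP c2.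
- have c0 : c *+ 2 = 0 by apply/eqP; rewrite -sqrf_eq0 c2.
  rewrite (iter 2%N 12 (-1)) => [|j].
    by rewrite (exprM _ 2 6) sqrrN !expr1n scale1r.
  by rewrite walk_pow_step c0 scale0r sub0r scaleN1r.
- rewrite (iter 6%N 4 1) => [|j]; first by rewrite expr1n scale1r.
  rewrite scale1r !addSn add0n !dbl c2.
  rewrite (_ : 1 - 2%:R = -1 :> C); last by ring.
  by rewrite !scaleN1r opprD opprK addrAC addrN add0r opprK.
- rewrite (iter 4%N 6 (-1)) => [|j].
    by rewrite (exprM _ 2 3) sqrrN !expr1n scale1r.
  by rewrite dbl c2 subrr scale0r sub0r scaleN1r.
- rewrite (iter 6%N 4 (-1)) => [|j].
    by rewrite (exprM _ 2 2) sqrrN !expr1n scale1r.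
  rewrite !addSn add0n !dbl c2.
  rewrite (_ : 3%:R - 2%:R = 1 :> C); last by ring.
  by rewrite !scale1r addrAC subrr add0r scaleN1r.
Qed.

End Eigenvector.

(** Both factors of [U] are self-adjoint involutions. *)
Lemma walk_unitary (tau : nat) : (U ^+ tau)^t* *m U ^+ tau = 1%:M.
Proof.
have UU : U^t* *m U = 1%:M.
  have Rh : (2%:R *: (d^t* *m d) - 1%:M)^t* = 2%:R *: (d^t* *m d) - 1%:M.
    rewrite linearB linearZ map_mxB map_mxZ /= trmxC_mul trmxCK.
    by rewrite trmx1 map_mx1 conjC_nat.
  rewrite /U trmxC_mul Rh S_herm mulmxA -(mulmxA _ S S) S_inv mulmx1.
  rewrite mulmxBl mul1mx mulmxBr mulmx1 -scalemxAl -scalemxAr -mulmxA.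
  rewrite (mulmxA d) d_coisometry mul1mx scalerA opprB addrA.
  rewrite (_ : 2%:R * 2%:R = 2%:R + 2%:R :> C); last by ring.
  by rewrite scalerDl addrK addrAC subrr add0r.
elim: tau => [|tau IHtau]; first by rewrite expr0 trmx1 map_mx1 mulmx1.
rewrite exprS -mulmxE trmxC_mul mulmxA -(mulmxA _ _ U) UU mulmx1.
exact: IHtau.
Qed.

(* On the orthogonal complement of the span of the columns of [d^t*] and
   [S d^t*], the walk acts as [- S], an involution. *)
Lemma walk_periodic24 :
    (forall c, root (char_poly T) c ->
       c ^+ 2 = 1 \/ (c *+ 2) ^+ 2 \in [:: 0; 1; 2%:R; 3%:R]) ->
  U ^+ 24 = 1%:M.
Proof.
move=> specT; set Q := U ^+ 24.
have Tnormal : T \is normalmx.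
  apply/normalmxP; congr (_ *m _); rewrite /T;
  by rewrite !trmxC_mul trmxCK S_herm mulmxA.
have Qd : Q *m d^t* = d^t*.
  apply: (normalmx_eq_on_eigenvectors Tnormal) => c v /specT c24 Tv.
  by rewrite -mulmxA; apply: walk_period24 Tv c24.
have QSd : Q *m (S *m d^t*) = S *m d^t*.
  rewrite -walk_boundary mulmxA /Q mulmxE -exprSr exprS -mulmxE -mulmxA.
  by rewrite -/Q Qd.
(* A unitary matrix and its adjoint fix the same vectors. *)
have adj (q : nat) (B : 'M[C]_(m, q)) : Q *m B = B -> B^t* *m Q = B^t*.
  move=> QB; rewrite -[LHS]trmxCK trmxC_mul trmxCK; congr (_^t*).
  by rewrite -[in LHS]QB mulmxA walk_unitary mul1mx.
(* The columns of [P] are orthogonal to everything [Q] fixes, in particular to the ranges of the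
   adjoint of [d] and of its image under [S]. *)
pose P := Q - 1%:M.
have dP : d *m P = 0.
  by rewrite mulmxBr mulmx1 -[d]trmxCK (adj _ _ Qd) subrr.
have dSP : d *m S *m P = 0.
  have := adj _ _ QSd; rewrite trmxC_mul trmxCK S_herm => dSQ.
  by rewrite mulmxBr mulmx1 dSQ subrr.
have UP (B : 'M[C]_m) : d *m B = 0 -> U *m B = - (S *m B).
  move=> dB; rewrite /U -mulmxA mulmxBl -scalemxAl -mulmxA dB mulmx0 scaler0.
  by rewrite sub0r mul1mx mulmxN.
have U2P : U *m (U *m P) = P.
  by rewrite (UP _ dP) mulmxN UP ?mulmxA // S_inv mul1mx opprK.
have QP : Q *m P = P.
  rewrite /Q (exprM U 2 12); elim: 12%N => [|j IHj]; first by rewrite mul1mx.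
  by rewrite exprS -mulmxE -mulmxA IHj expr2 -mulmxE -mulmxA.
(* As [Q] is unitary and fixes [P], its adjoint fixes [P] too, so the adjoint of [P] times [P] is
   [P - P]. *)
apply/eqP; rewrite -subr_eq0; apply/eqP/ctmx_mul_eq0.
have -> : (Q - 1%:M)^t* = Q^t* - 1%:M.
  by rewrite linearB map_mxB /= trmx1 map_mx1.
by rewrite -/P mulmxBl mul1mx -{1}QP mulmxA walk_unitary mul1mx subrr.
Qed.

End AbstractWalk.

Lemma sum_enum_val (M : nmodType) (T : finType) (F : T -> M) :
  \sum_(i < #|T|) F (enum_val i) = \sum_x F x.
Proof. by rewrite -(big_enum_val (A := T)). Qed.

(** * Boundary and shift matrices of a graph *)

Section GraphWalk.

Variables (C : numClosedFieldType) (V : finType) (e : rel V).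
Hypotheses (e_sym : symmetric e).

Lemma arc_rev_subproof (u : Defs.arc e) : e (val u).2 (val u).1.
Proof. by rewrite e_sym (valP u). Qed.

(** Symmetry of [e] turns the relation [inverse_arc] into an operation, which makes [shift] the
    matrix of a permutation. *)
Definition arc_rev (u : Defs.arc e) : Defs.arc e :=
  exist _ ((val u).2, (val u).1) (arc_rev_subproof u).

Lemma inverse_arcE (u v : Defs.arc e) : inverse_arc u v = (u == arc_rev v).
Proof. by []. Qed.

Lemma arc_revK : involutive arc_rev.
Proof. by move=> u; apply: val_inj => /=; case: (val u). Qed.

Lemma shift_entry (i j : 'I_#|Defs.arc e|) :
  shift C e i j = (enum_val i == arc_rev (enum_val j))%:R.
Proof. by rewrite mxE inverse_arcE. Qed.

Lemma mulmx_shift (p : nat) (B : 'M[C]_(p, #|Defs.arc e|)) i j :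
  (B *m shift C e) i j = B i (enum_rank (arc_rev (enum_val j))).
Proof.
rewrite mxE (bigD1 (enum_rank (arc_rev (enum_val j)))) //= big1 => [|l lj].
  by rewrite shift_entry enum_rankK eqxx mulr1 addr0.
by rewrite shift_entry -(inj_eq enum_rank_inj) enum_valK (negPf lj) mulr0.
Qed.

Lemma shift_inv : shift C e *m shift C e = 1%:M.
Proof.
apply/matrixP => i j; rewrite mulmx_shift shift_entry enum_rankK arc_revK.
by rewrite !mxE (inj_eq enum_val_inj).
Qed.

Lemma shift_herm : (shift C e)^t* = shift C e.
Proof.
apply/matrixP => i j; rewrite !mxE conjC_nat !inverse_arcE.
congr ((nat_of_bool _)%:R).
by rewrite -(inj_eq (inv_inj arc_revK)) arc_revK eq_sym.
Qed.

Lemma sum_arc (M : nmodType) (F : V * V -> M) :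
  \sum_(u : Defs.arc e) F (val u) = \sum_x \sum_(y | e x y) F (x, y).
Proof.
rewrite pair_big_dep /=.
rewrite (reindex_omap (fun u : Defs.arc e => val u) insub)
  => [|p ep]; last first.
  by rewrite insubT.
by apply: eq_big => [u|[[x y] exy]] //=; rewrite (valP u) valK eqxx.
Qed.

Lemma boundary_ctE i j : (boundary C e)^t* i j = boundary C e j i.
Proof.
rewrite !mxE rmorphM fmorphV /= conjC_nat (CrealP _) //.
by rewrite ger0_real // sqrtC_ge0 ler0n.
Qed.

(** Arcs ending at [x] correspond to its in-neighbours; [deg] counts out-neighbours, and symmetry
    identifies the two. *)
Lemma card_terminus (x : V) :
  \sum_(u : Defs.arc e) (x == terminus u)%:R = (deg e x)%:R :> C.
Proof.
rewrite (sum_arc (fun p => (x == p.2)%:R)) (exchange_big_dep predT) //=.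
rewrite (bigD1 x) //=.
rewrite [X in _ + X]big1 => [|y /negPf yx]; last first.
  by rewrite big1 // => z _; rewrite eq_sym yx.
rewrite addr0 eqxx sumr_const; congr (_ *+ _).
by apply: eq_card => y; rewrite !inE e_sym.
Qed.

(** An arc has a single terminus, so distinct rows of the boundary have disjoint supports; the row
    of [x] has [deg e x] nonzero entries, each of square 1 / [deg e x]. *)
Lemma boundary_coisometry :
  (forall x, deg e x != 0%N) ->
  boundary C e *m (boundary C e)^t* = 1%:M.
Proof.
move=> deg0; apply/matrixP => i j; rewrite [LHS]mxE mxE.
set r := fun x => (sqrtC (deg e x)%:R)^-1 : C.
transitivity (\sum_(u : Defs.arc e) (i == j)%:R * (r (enum_val i) ^+ 2 *
    (enum_val i == terminus u)%:R)).
  rewrite -[RHS]sum_enum_val; apply: eq_bigr => l _; rewrite boundary_ctE !mxE.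
  case: (eqVneq i j) => [<-|ij].
    by rewrite mul1r mulrACA -expr2 -natrM mulnb andbb.
  case: eqP => [<-|_]; last by rewrite mulr0 !mul0r.
  by rewrite (inj_eq enum_val_inj) eq_sym (negPf ij) !mulr0 mul0r.
rewrite -!mulr_sumr card_terminus /r exprVn sqrtCK mulVf ?mulr1 //.
by rewrite pnatr_eq0.
Qed.

(** The only arc that can contribute to the entry is the one from vertex [i] to vertex [j], which
    exists exactly when they are adjacent. *)
Lemma boundary_shift_boundary (i j : 'I_#|V|) :
  (boundary C e *m shift C e *m (boundary C e)^t*) i j =
  (sqrtC (deg e (enum_val i))%:R)^-1 * (sqrtC (deg e (enum_val j))%:R)^-1
  * adjacency C e i j.
Proof.
rewrite !mxE.
set r := fun x => (sqrtC (deg e x)%:R)^-1 : C.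
transitivity (\sum_(u : Defs.arc e) r (enum_val i) * r (enum_val j) *
    ((enum_val i, enum_val j) == val u)%:R).
  rewrite -[RHS]sum_enum_val; apply: eq_bigr => l _.
  rewrite boundary_ctE mulmx_shift !mxE enum_rankK mulrACA -natrM mulnb.
  by congr (_ * (nat_of_bool _)%:R); rewrite [RHS]xpair_eqE.
rewrite -mulr_sumr; congr (_ * _).
rewrite (sum_arc (fun p => ((enum_val i, enum_val j) == p)%:R)).
rewrite (bigD1 (enum_val i)) //= [X in _ + X]big1 => [|x /negPf xi]; last first.
  by rewrite big1 // => y _; rewrite xpair_eqE eq_sym xi.
rewrite addr0; under eq_bigr do rewrite xpair_eqE eqxx andTb.
case: (boolP (e (enum_val i) (enum_val j))) => eij.
  rewrite (bigD1 (enum_val j)) //= eqxx big1 ?addr0 // => y /andP[_ /negPf yj].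
  by rewrite eq_sym yj.
by rewrite big1 // => y eiy; case: eqP eij => // ->; rewrite eiy.
Qed.

End GraphWalk.

(** * Adjacency matrices of regular graphs, spectra and traces *)

Lemma regular_boundary_shift_boundary (C : numClosedFieldType) (V : finType)
    (e : rel V) (k : nat) :
  symmetric e -> regular e k ->
  boundary C e *m shift C e *m (boundary C e)^t* = k%:R^-1 *: adjacency C e.
Proof.
move=> e_sym e_reg; apply/matrixP => i j; rewrite boundary_shift_boundary //.
by rewrite !e_reg -expr2 exprVn sqrtCK [RHS]mxE.
Qed.

Lemma adjacency_normal (C : numClosedFieldType) (V : finType) (e : rel V) :
  symmetric e -> adjacency C e \is normalmx.
Proof.
move=> e_sym; apply/normalmxP.
suff -> : (adjacency C e)^t* = adjacency C e by [].
by apply/matrixP => i j; rewrite !mxE conjC_nat e_sym.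
Qed.

(** The trace counts closed walks of length 2, of which [k] start at each vertex. *)
Lemma mxtrace_adjacency_sqr (C : numClosedFieldType) (V : finType) (e : rel V)
    (k : nat) :
  symmetric e -> regular e k ->
  \tr (adjacency C e *m adjacency C e) = (k * #|V|)%:R.
Proof.
move=> e_sym e_reg; rewrite /mxtrace.
transitivity (\sum_(i < #|V|) k%:R : C); last first.
  by rewrite sumr_const card_ord natrM mulr_natr.
apply: eq_bigr => i _; rewrite mxE -(e_reg (enum_val i)).
transitivity (\sum_(y | e (enum_val i) y) 1 : C); last first.
  by rewrite sumr_const; congr (_ *+ _); apply: eq_card => y; rewrite inE.
rewrite [RHS]big_mkcond /= -[RHS]sum_enum_val; apply: eq_bigr => j _.
by rewrite !mxE (e_sym (enum_val j)); case: (e _ _); rewrite ?mulr1 ?mulr0.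
Qed.

Lemma char_poly_spectrum (C : numClosedFieldType) (n : nat) (A : 'M[C]_n) :
  char_poly A = \prod_(z <- spectrum A) ('X - z%:P).
Proof.
rewrite /spectrum; case: closed_field_poly_normal => s /= {1}->.
by rewrite (monicP (char_poly_monic A)) scale1r.
Qed.

Lemma root_char_poly_spectrum (C : numClosedFieldType) (n : nat) (A : 'M[C]_n)
    (c : C) :
  root (char_poly A) c = (c \in spectrum A).
Proof. by rewrite char_poly_spectrum root_prod_XsubC. Qed.

(** Unitary diagonalization: the diagonal and [spectrum A] factor the same characteristic
    polynomial, so they agree up to order. *)
Lemma mxtrace_sqr_normalmx (C : numClosedFieldType) (n : nat) (A : 'M[C]_n) :
  A \is normalmx -> \tr (A *m A) = \sum_(z <- spectrum A) z ^+ 2.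
Proof.
move=> An; set D := spectral_diag A.
have Aspec : perm_eq (spectrum A) [seq D 0 i | i : 'I_n].
  apply: prod_XsubC_eq; rewrite -char_poly_spectrum char_poly_normalmx //.
  by rewrite big_map big_enum.
rewrite (perm_big _ Aspec) big_map big_enum /=.
have := An => /orthomx_spectralP AE; set P := spectralmx A in AE.
have Pu : P \in unitmx by apply: spectral_unit.
rewrite AE -/D !mulmxA mulmxK // mxtrace_mulC !mulmxA mulmxV // mul1mx.
by rewrite mulmx_diag mxtrace_diag; apply: eq_bigr => i _; rewrite mxE expr2.
Qed.

Lemma root_char_poly_scale (C : numClosedFieldType) (n : nat) (A : 'M[C]_n)
    (s c : C) :
  s != 0 -> root (char_poly (s^-1 *: A)) c = root (char_poly A) (s * c).
Proof.
move=> s0; rewrite -!eigenvalue_root_char.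
apply/eigenvalueP/eigenvalueP => -[v vA v0]; exists v => //.
  by rewrite -scalerA -vA -scalemxAr scalerA mulfV // scale1r.
by rewrite -scalemxAr vA scalerA mulKf.
Qed.

(** * Algebraic integers and the admissible values of theta *)

Lemma integral_unity_root (C : numClosedFieldType) (tau : nat) (mu : C) :
  (0 < tau)%N -> mu ^+ tau = 1 -> integralOver (intr : int -> C) mu.
Proof.
move=> tau0 mu1; exists ('X^tau - 1); first exact: monicXnsubC.
rewrite rmorphB rmorph1 rmorphXn /= map_polyX /root !hornerE.
by rewrite mu1 subrr.
Qed.

(** Being a root of an integer polynomial descends from [C] to [rat] and lifts to [algC], where
    rational algebraic integers are known to be integers. *)
Lemma integral_ratr_int (C : numClosedFieldType) (q : rat) :
  integralOver (intr : int -> C) (ratr q) -> exists z : int, q = z%:~R.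
Proof.
case=> p p_monic.
have -> : map_poly intr p = map_poly (ratr : rat -> C) (map_poly intr p).
  by rewrite -map_poly_comp; apply: eq_map_poly => z /=; rewrite ratr_int.
rewrite fmorph_root -(fmorph_root (ratr : {rmorphism rat -> algC})) => pq.
suff /intrP[z qz] : (ratr q : algC) \is a Num.int.
  exists z; apply: (fmorph_inj (ratr : {rmorphism rat -> algC})).
  by rewrite /= qz /= ratr_int.
apply: Cint_rat_Aint; first by apply/CratP; exists q.
apply: root_monic_Aint pq _ _; first by rewrite !monic_map.
by apply/polyOverP => i; rewrite !coef_map /= ratr_int.
Qed.

Lemma unity_cosine_list (C : numClosedFieldType) (k tau : nat) (theta mu : C)
    (q : rat) :
  (0 < k)%N -> 0 < theta -> theta != k%:R ->
  theta ^+ 2 = ratr q -> integralOver (intr : int -> C) theta ->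
  (0 < tau)%N -> mu ^+ tau = 1 -> mu ^+ 2 + 1 = (theta / k%:R) *+ 2 * mu ->
  ~~ odd k /\
  theta \in [:: k%:R / 2%:R; sqrtC 2%:R / 2%:R * k%:R;
                sqrtC 3%:R / 2%:R * k%:R].
Proof.
move=> k_gt0 theta_gt0 theta_neq_k theta_rat theta_int tau_gt0 mu1 mu_eq.
have k0 : k%:R != 0 :> C by rewrite pnatr_eq0 -lt0n.
have kpos : 0 < k%:R :> C by rewrite ltr0n.
have mu0 : mu != 0.
  by apply: contra_eq_neq mu1 => ->; rewrite expr0n gtn_eqF // eq_sym oner_eq0.
set x := (theta / k%:R) *+ 2 in mu_eq.
have xE : x = mu + mu^-1.
  by apply: (mulIf mu0); rewrite -mu_eq mulrDl mulVf // expr2.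
have x_gt0 : 0 < x by rewrite pmulrn_lgt0 // divr_gt0.
have x_lt2 : x < 2%:R.
  have mu_norm : `|mu| = 1.
    by apply/eqP; rewrite -(pexpr_eq1 tau_gt0) // -normrX mu1 normr1.
  (* The value 2 would mean [theta = k%:R]; the weak bound is the triangle inequality for
     [mu + mu^-1]. *)
  rewrite lt_neqAle; apply/andP; split.
    apply: contra theta_neq_k; rewrite -[x]mulr_natr => /eqP x2.
    have /(canRL (mulfVK k0)) -> : theta / k%:R = 1.
      by apply: (mulIf (_ : 2%:R != 0)); rewrite ?pnatr_eq0 // mul1r.
    by rewrite mul1r.
  rewrite -(gtr0_norm x_gt0) xE (le_trans (ler_normD _ _)) //.
  by rewrite normfV mu_norm invr1.
have [z xz] : exists z : int, x ^+ 2 = z%:~R.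
  have xq : x ^+ 2 = ratr (q / k%:R ^+ 2 * 4%:R).
    rewrite rmorphM fmorph_div rmorphXn /= -theta_rat !ratr_nat /x -mulr_natr.
    by rewrite exprMn expr_div_n -!natrX.
  have : integralOver (intr : int -> C) (x ^+ 2).
    have xint : integralOver (intr : int -> C) x.
      rewrite xE; apply: integral_add; first exact: integral_unity_root mu1.
      by apply: (@integral_unity_root _ tau) => //; rewrite exprVn mu1 invr1.
    by rewrite expr2; apply: integral_mul.
  rewrite xq => /integral_ratr_int[z ->].
  by exists z; rewrite ratr_int.
have [w thetaw] : exists w : int, theta ^+ 2 = w%:~R.
  have : integralOver (intr : int -> C) (theta ^+ 2).
    by rewrite expr2; apply: integral_mul.
  rewrite theta_rat => /integral_ratr_int[w ->].
  by exists w; rewrite ratr_int.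
have zk : z * (k%:Z * k%:Z) = 4 * w.
  apply: (@intr_inj C); rewrite !rmorphM /= -xz -thetaw /x -mulr_natr.
  by field.
have theta_x : theta = x / 2%:R * k%:R by rewrite /x -mulr_natr; field.
have z_bounds : (0 < z < 4)%R.
  rewrite -2!(ltr_int C) -xz exprn_gt0 //=.
  rewrite (_ : 4%:~R = 2%:R ^+ 2 :> C); last by ring.
  by rewrite ltr_pXn2r // nnegrE ltW.
have xsqrt : x = sqrtC z%:~R by rewrite -xz sqrCK // ltW.
have z_cases : z = 1 \/ z = 2 \/ z = 3 by lia.
split.
  (* For odd [k], k^2 is 1 modulo 4, so [zk] would make [z] divisible by 4. Writing k = 2 m + 1
     exposes this to [lia]. *)
  apply/negP => k_odd; have kE : k = (k./2 + k./2 + 1)%N.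
    by rewrite -[LHS]odd_double_half k_odd addnC addnn.
  by rewrite kE !PoszD in zk; case: z_cases => [|[|]] zE; rewrite zE in zk; lia.
rewrite theta_x xsqrt !inE.
case: z_cases => [|[|]] ->; last 2 first.
- by rewrite eqxx orbT.
- by rewrite eqxx !orbT.
by rewrite sqrtC1 mul1r mulrC eqxx.
Qed.

(** * The given spectrum and the equivalence *)

Lemma sum_symmetric_spectrum_sqr (R : comNzRingType) (s : seq R) (k theta : R)
    (a b : nat) :
  perm_eq s ([:: k; - k] ++ nseq a theta ++ nseq a (- theta) ++ nseq b 0) ->
  \sum_(z <- s) z ^+ 2 = k ^+ 2 *+ 2 + theta ^+ 2 *+ (a + a).
Proof.
move=> sE; rewrite (perm_big _ sE) /= !big_cons !big_cat /= !big_nseq.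
rewrite !iter_addr_0 !sqrrN expr0n mul0rn addr0 addrA.
by rewrite mulr2n mulrnDr.
Qed.

(** The matrix has integer entries, so its characteristic polynomial is monic over the integers. *)
Lemma integral_adjacency_eigenvalue (C : numClosedFieldType) (V : finType)
    (e : rel V) (c : C) :
  root (char_poly (adjacency C e)) c -> integralOver (intr : int -> C) c.
Proof.
pose B : 'M[int]_#|V| := \matrix_(i, j) (e (enum_val i) (enum_val j))%:R.
have -> : adjacency C e = map_mx intr B.
  by apply/matrixP => i j; rewrite !mxE; case: (e _ _).
rewrite -map_char_poly => croot.
by exists (char_poly B); first exact: char_poly_monic.
Qed.

Theorem theorem1p1 (C : numClosedFieldType) (V : finType) (e : rel V)
    (k a b : nat) (theta : C)
    (e_simple : simple_graph e)
    (e_connected : connected_graph e)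
    (e_bipartite : bipartite e)
    (e_regular : regular e k)
    (a_ge1 : (1 <= a)%N)
    (theta_gt0 : 0 < theta)
    (distinct : uniq [:: k%:R; - k%:R; theta; - theta])
    (distinct0 : (1 <= b)%N -> 0 \notin [:: k%:R; - k%:R; theta; - theta])
    (e_spectrum : perm_eq (spectrum (adjacency C e))
       ([:: k%:R; - k%:R] ++ nseq a theta ++ nseq a (- theta) ++ nseq b 0)) :
  periodic C e <->
  ~~ odd k /\
  theta \in [:: k%:R / 2%:R; sqrtC 2%:R / 2%:R * k%:R;
                sqrtC 3%:R / 2%:R * k%:R].
Proof.
have [e_sym _] := e_simple.
have [k_neq theta_neq_k] : (k%:R != - k%:R :> C) /\ theta != k%:R.
  move: distinct; rewrite /= !inE !negb_or => /andP[/and3P[-> kt _] _].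
  by rewrite eq_sym kt.
have k_gt0 : (0 < k)%N.
  by case: (k) k_neq => // /negP; rewrite oppr0 eqxx.
have k0 : k%:R != 0 :> C by rewrite pnatr_eq0 -lt0n.
have coiso := boundary_coisometry C e_sym (fun x =>
  eq_ind_r (fun l => l != 0%N) (lt0n_neq0 k_gt0) (e_regular x)).
have inv := shift_inv C e_sym; have herm := shift_herm C e_sym.
have TE := regular_boundary_shift_boundary C e_sym e_regular.
set A := adjacency C e in e_spectrum TE.
have rootT c :
    root (char_poly (boundary C e *m shift C e *m (boundary C e)^t*)) c =
    (k%:R * c \in spectrum A).
  by rewrite TE root_char_poly_scale // root_char_poly_spectrum.
have theta_spec : theta \in spectrum A.
  by rewrite (perm_mem e_spectrum) !mem_cat !mem_nseq a_ge1 eqxx !orbT.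
split=> [[tau tau_gt0 Utau]|[k_even theta_list]].
  set c := theta / k%:R.
  have c_sqr : c ^+ 2 != 1.
    rewrite sqrf_eq1 negb_or; apply/andP; split.
      apply: contra theta_neq_k => /eqP c1.
      by rewrite -(divfK k0 theta) -/c c1 mul1r.
    by rewrite gt_eqF // (lt_trans (ltrN10 _)) // divr_gt0 // ltr0n.
  have : eigenvalue (boundary C e *m shift C e *m (boundary C e)^t*) c.
    by rewrite eigenvalue_root_char rootT mulrC divfK.
  case/eigenvalueP => v vT v0.
  (* [eigenvalueP] provides a row eigenvector; the matrix is symmetric, so transposing gives a
     column eigenvector. *)
  have Tv : boundary C e *m shift C e *m (boundary C e)^t* *m v^T = c *: v^T.
    rewrite -linearZ -vT /= trmx_mul; congr (_ *m _); rewrite TE linearZ /=.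
    by congr (_ *: _); apply/matrixP => i j; rewrite !mxE e_sym.
  (* A root of X^2 - 2 c X + 1, by the quadratic formula. *)
  pose mu := c + sqrtC (c ^+ 2 - 1).
  have mu_eq : mu ^+ 2 + 1 = c *+ 2 * mu.
    have rE := sqrtCK (c ^+ 2 - 1).
    by rewrite /mu sqrrD rE -mulr_natl; ring.
  have mu1 : mu ^+ tau = 1.
    apply: (walk_eigenvalue_order coiso inv Tv _ c_sqr mu_eq Utau).
    by rewrite trmx_eq0.
  have trace := mxtrace_adjacency_sqr C e_sym e_regular.
  rewrite (mxtrace_sqr_normalmx (adjacency_normal C e_sym)) in trace.
  rewrite (sum_symmetric_spectrum_sqr e_spectrum) in trace.
  (* Solves k |V| = 2 k^2 + 2 a theta^2, the two evaluations of the trace, for theta^2. *)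
  pose q : rat := ((k * #|V|)%:R - (2 * k ^ 2)%:R) / (a + a)%:R.
  apply: (unity_cosine_list (q := q) k_gt0 theta_gt0 theta_neq_k
    _ _ tau_gt0 mu1 mu_eq).
    rewrite fmorph_div rmorphB /= !ratr_nat -trace natrM natrX.
    rewrite mulr_natl addrAC subrr.
    by rewrite add0r -mulr_natr mulfK // pnatr_eq0 addn_eq0 andbb -lt0n.
  apply: (integral_adjacency_eigenvalue (e := e)).
  by rewrite root_char_poly_spectrum.
exists 24%N => //; apply: (walk_periodic24 coiso inv herm) => c.
have theta_sqr : (theta / k%:R *+ 2) ^+ 2 \in [:: 1; 2%:R; 3%:R].
  move: theta_list; rewrite !inE => /or3P[] /eqP ->.
  - by rewrite [X in X ^+ 2](_ : _ = 1) ?expr1n ?eqxx //; field.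
  - by rewrite [X in X ^+ 2](_ : _ = sqrtC 2%:R) ?sqrtCK ?eqxx ?orbT //; field.
  - by rewrite [X in X ^+ 2](_ : _ = sqrtC 3%:R) ?sqrtCK ?eqxx ?orbT //; field.
rewrite rootT (perm_mem e_spectrum) !mem_cat !mem_nseq !inE.
rewrite !inE in theta_sqr.
have cE (z : C) : k%:R * c = z -> c = z / k%:R.
  by move=> <-; rewrite mulrC mulKf.
(* The eigenvalues k and -k give c^2 = 1, theta and -theta give (2 c)^2 in {1, 2, 3}, and 0 gives
   0. *)
case/or4P=> [/orP[]|/andP[_]|/andP[_]|/andP[_]] /eqP /cE ->.
- by left; rewrite divff // expr1n.
- by left; rewrite mulNr divff // sqrrN expr1n.
- by right; rewrite theta_sqr orbT.
- by right; rewrite mulNr mulNrn sqrrN theta_sqr orbT.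
- by right; rewrite mul0r mul0rn expr0n eqxx.
Qed.
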